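(* Let $0 \le k \le n/2$ and $A = S(n,k)$. Let $r(x) = \frac{3 - \sqrt{1 + 8(1-2x)^2}}{8}$ and define on $[0,\tfrac12]$ \[ \psi(x) = H\big(2r(x)\big) + 4r(x) + 2\big(1-2r(x)\big) H\!\left(\frac{x - r(x)}{1-2r(x)}\right) - 2H(x). \] Then (1) $\mu(A) \le 2^{n \psi(k/n)}$; (2) $2^{n\psi(k/n)} \le C \max(1,k)^{3/2} \cdot \frac{E_2(A,A)}{|A|^2}$, where $C$ is an absolute constant.
   Context: Identify $\{0,1\}^n$ with $\mathbb{F}_2^n$. $S(n,k) = \{x : \sum_i x_i = k\}$. $H(p) = -p\log_2 p - (1-p)\log_2(1-p)$ is the binary entropy, $H(0)=H(1)=0$. Walsh characters $W_\alpha(x) = (-1)^{\sum_i\alpha_i x_i}$; $f=\sum_\alpha\hat f(\alpha)W_\alpha$. $\mathbb{E}$ is uniform. $\mu(A) = \max \frac{\mathbb{E} f^4}{(\mathbb{E} f^2)^2}$ over nonzero real $f$ with $\hat f$ supported in $A$. $E_2(A,A) = |\{(a,b,c,d)\in A^4 : a+b+c+d=0\}|$. *)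

(* Defs.v *)
From HB Require Import structures.
From mathcomp Require Import all_boot all_order all_algebra.
From mathcomp Require Import all_classical all_reals all_analysis.

Set Implicit Arguments.
Unset Strict Implicit.
Unset Printing Implicit Defensive.

Import Order.TTheory GRing.Theory Num.Theory.
Import numFieldNormedType.Exports.

Local Open Scope classical_set_scope.
Local Open Scope ring_scope.

(* The cube {0,1}^n, identified with F_2^n. *)
Notation cube n := 'rV['F_2]_n.

Definition slice (n k : nat) : {set cube n} :=
  [set x : cube n | (\sum_(i < n) (x 0%R i : nat))%N == k]%SET.

Definition E2 (n : nat) (A : {set cube n}) : nat :=
  #|[set t : cube n * cube n * cube n * cube n |
      let: (a, b, c, d) := t in
      [&& a \in A, b \in A, c \in A, d \in A & a + b + c + d == 0]]%SET|.

Definition expect (R : realType) (n : nat) (f : cube n -> R) : R :=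
  (\sum_(x : cube n) f x) / #|{: cube n}|%:R.

Definition walsh (R : realType) (n : nat) (a x : cube n) : R :=
  (-1) ^+ (\sum_(i < n) ((a 0%R i : nat) * (x 0%R i : nat)))%N.

(* The coefficients of f in the Walsh basis: see [fourier_inversion]. *)
Definition fourier (R : realType) (n : nat) (f : cube n -> R) (a : cube n) : R :=
  expect (fun x => f x * walsh R a x).

Definition fourier_supported (R : realType) (n : nat) (f : cube n -> R)
  (A : {set cube n}) : Prop :=
  forall a, a \notin A -> fourier f a = 0.

Definition mu_ratios (R : realType) (n : nat) (A : {set cube n}) : set R :=
  [set expect (fun x => f x ^+ 4) / expect (fun x => f x ^+ 2) ^+ 2
    | f in [set f : cube n -> R |
             (exists x, f x != 0) /\ fourier_supported f A]].

Arguments mu_ratios R {n} A _.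

(* A maximum over a nonempty A, attained: see [mu_max]. *)
Definition mu (R : realType) (n : nat) (A : {set cube n}) : R :=
  sup (mu_ratios R A).

Definition log2 (R : realType) (x : R) : R := ln x / ln 2.

(* ln 0 is multiplied by 0 at the endpoints: see [entropy0], [entropy1]. *)
Definition entropy (R : realType) (p : R) : R :=
  - p * log2 p - (1 - p) * log2 (1 - p).

Definition rfun (R : realType) (x : R) : R :=
  (3 - Num.sqrt (1 + 8 * (1 - 2 * x) ^+ 2)) / 8.

Definition psi (R : realType) (x : R) : R :=
  entropy (2 * rfun x) + 4 * rfun x
  + 2 * (1 - 2 * rfun x) * entropy ((x - rfun x) / (1 - 2 * rfun x))
  - 2 * entropy x.

Lemma log2_1 (R : realType) : log2 (1 : R) = 0.
Proof. by rewrite /log2 ln1 mul0r. Qed.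

Lemma entropy0 (R : realType) : entropy (0 : R) = 0.
Proof. by rewrite /entropy subr0 log2_1 oppr0 !mul0r mulr0 subrr. Qed.

Lemma entropy1 (R : realType) : entropy (1 : R) = 0.
Proof. by rewrite /entropy log2_1 subrr mul0r mulr0 subrr. Qed.

Section Fourier.
Variables (R : realType) (n : nat).
Implicit Types (a b x y : cube n) (f : cube n -> R).

Lemma card_cube_neq0 : #|{: cube n}|%:R != 0 :> R.
Proof. by rewrite pnatr_eq0 -lt0n; apply/card_gt0P; exists 0. Qed.

Lemma walshC a x : walsh R a x = walsh R x a.
Proof. by rewrite /walsh; congr (_ ^+ _); apply: eq_bigr => i _; rewrite mulnC. Qed.

Lemma walshD a x y : walsh R a (x + y) = walsh R a x * walsh R a y.
Proof.
rewrite /walsh -!prodrXr -big_split /=; apply: eq_bigr => i _; rewrite !mxE.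
case: (a 0 i) (x 0 i) (y 0 i) => [[|[|//]] ?] [[|[|//]] ?] [[|[|//]] ?] /=;
by rewrite ?mul0n ?muln0 ?mul1n ?modnn ?modn_small /= ?(expr0, expr1) ?(mul1r, mulr1) ?mulrN1 ?opprK.
Qed.

Lemma sum_walsh a : \sum_x walsh R a x = if a == 0 then #|{: cube n}|%:R else 0.
Proof.
have [->|a0] := eqVneq.
  rewrite -sumr_const; apply: eq_bigr => x _.
  by rewrite /walsh big1 ?expr0 // => i _; rewrite mxE mul0n.
have [i ai] : exists i, a 0 i != 0.
  apply/existsP; apply: contraNT a0 => /existsPn h; apply/eqP/rowP => i.
  by rewrite mxE; apply/eqP; have := h i; rewrite negbK.
have We : walsh R a (delta_mx 0 i) = -1.
  rewrite /walsh (bigD1 i) //= big1 => [|j ji]; last first.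
    by rewrite mxE eqxx (negPf ji) muln0.
  by rewrite mxE !eqxx; case: (a 0 i) ai => [[|[|//]] ?].
have : \sum_x walsh R a x = - \sum_x walsh R a x.
  rewrite [LHS](reindex_inj (addIr (delta_mx 0 i))) -sumrN.
  by apply: eq_bigr => x _; rewrite walshD We mulrN1.
by move/eqP; rewrite -addr_eq0 -mulr2n mulrn_eq0 /= => /eqP.
Qed.

Lemma walsh_orthogonal x y :
  \sum_a walsh R a x * walsh R a y = if x == y then #|{: cube n}|%:R else 0.
Proof.
transitivity (\sum_a walsh R (x - y) a).
  apply: eq_bigr => a _; rewrite -walshD walshC; congr (walsh R _ a).
  apply/rowP => i; rewrite !mxE; congr (_ + _).
  by apply: val_inj; case: (y 0 i) => [[|[|//]] ?].
by rewrite sum_walsh subr_eq0.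
Qed.

Lemma fourier_inversion f x : f x = \sum_a fourier f a * walsh R a x.
Proof.
rewrite /fourier /expect.
under eq_bigr do rewrite mulrAC mulr_suml.
rewrite -mulr_suml exchange_big /=.
under eq_bigr => y _ do
  under eq_bigr do rewrite -mulrA.
under eq_bigr do rewrite -mulr_sumr walsh_orthogonal.
rewrite (bigD1 x) //= eqxx big1 => [|y /negPf->]; last by rewrite mulr0.
by rewrite addr0 mulfK // card_cube_neq0.
Qed.

Lemma fourier_walsh a b : fourier (walsh R a) b = if a == b then 1 else 0.
Proof.
rewrite /fourier /expect.
under eq_bigr do rewrite walshC (walshC b).
rewrite walsh_orthogonal; case: ifP => _; last by rewrite mul0r.
by rewrite divff // card_cube_neq0.
Qed.

Lemma expect_sq_gt0 f x : f x != 0 -> 0 < expect (fun y => f y ^+ 2).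
Proof.
move=> fx0; rewrite /expect divr_gt0 //; last first.
  by rewrite lt0r card_cube_neq0 ler0n.
rewrite (bigD1 x) //= ltr_wpDr ?sumr_ge0 // => [y _|]; first exact: sqr_ge0.
by rewrite lt0r sqr_ge0 sqrf_eq0 fx0.
Qed.

Let fun_of_row (v : 'rV[R]_#|{: cube n}|) : cube n -> R :=
  fun x => v 0 (enum_rank x).

Let row_of_fun f : 'rV[R]_#|{: cube n}| := \row_i f (enum_val i).

Let row_of_funK f : fun_of_row (row_of_fun f) = f.
Proof. by apply/funext => x; rewrite /fun_of_row mxE enum_rankK. Qed.

Let fun_of_row_continuous x : continuous (fun v => fun_of_row v x).
Proof. exact: coord_continuous. Qed.

Let expect_continuous (T : topologicalType) (g : cube n -> T -> R) :
  (forall x, continuous (g x)) -> continuous (fun v => expect (g^~ v)).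
Proof.
move=> gc v; rewrite /expect; apply: cvgMr_tmp.
apply: (@cvg_big R^o) => [|x _]; last exact: gc.
exact: (@add_continuous R^o).
Qed.

Lemma mu_max (A : {set cube n}) : A != finset.set0 ->
  mu_ratios R A (mu R A) /\ ubound (mu_ratios R A) (mu R A).
Proof.
case/set0Pn => a0 a0A.
pose sq (v : 'rV[R]_#|{: cube n}|) := expect (fun x => fun_of_row v x ^+ 2).
pose q4 (v : 'rV[R]_#|{: cube n}|) := expect (fun x => fun_of_row v x ^+ 4).
have exp_cont m : continuous (fun v => expect (fun x => fun_of_row v x ^+ m)).
  apply: (expect_continuous (g := fun x v => fun_of_row v x ^+ m)) => x v.
  apply: (@continuous_comp _ _ _ (fun v => fun_of_row v x) (fun t => t ^+ m)).
    exact: fun_of_row_continuous.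
  exact: exprn_continuous.
have fou_cont a : continuous (fun v => fourier (fun_of_row v) a).
  apply: (expect_continuous (g := fun x v => fun_of_row v x * walsh R a x)) => x v.
  apply: (@continuousM _ _ (fun v => fun_of_row v x) (fun=> walsh R a x)).
    exact: fun_of_row_continuous.
  exact: cst_continuous.
pose K := [set v | sq v = 1] `&`
  \bigcap_(a in [set a | a \notin A]) [set v | fourier (fun_of_row v) a = 0].
have KE v : K v <-> sq v = 1 /\ fourier_supported (fun_of_row v) A by [].
have Kclosed : closed K.
  apply: closedI.
    apply: (@preimage_closed _ _ sq [set x | x = 1]); last exact: closed_eq.
    by move=> v _; exact: exp_cont.
  apply: closed_bigI => a _.
  apply: (@preimage_closed _ _ (fun v => fourier (fun_of_row v) a) [set x | x = 0]);
    last exact: closed_eq.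
  by move=> v _; exact: fou_cont.
have N0 := card_cube_neq0.
have Npos : 0 < #|{: cube n}|%:R :> R by rewrite lt0r N0 ler0n.
have N1 : 1 <= #|{: cube n}|%:R :> R by rewrite ler1n -(ltr0n R).
have Kbounded : bounded_set K.
  exists #|{: cube n}|%:R; split; first exact: num_real.
  move=> M ltM v /KE[v1 _] /=.
  have M0 : 0 <= M by rewrite (le_trans _ (ltW ltM)) // ler0n.
  rewrite /Num.norm /= mx_normrE; apply/bigmax_leP; split=> // -[i j] _ /=.
  rewrite (ord1 i) -ler_sqr ?nnegrE ?normr_ge0 // real_normK ?num_real //.
  apply: (@le_trans _ _ #|{: cube n}|%:R); last first.
    by rewrite (le_trans (ltW ltM)) // expr2 ler_peMr // (le_trans N1) // ltW.
  have <- : \sum_x fun_of_row v x ^+ 2 = #|{: cube n}|%:R.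
    by have := congr1 ( *%R^~ #|{: cube n}|%:R) v1; rewrite /sq /expect /= divfK // mul1r.
  rewrite (bigD1 (enum_val j)) //= /fun_of_row enum_valK lerDl sumr_ge0 // => x _.
  exact: sqr_ge0.
have scale f : (exists x, f x != 0) -> fourier_supported f A ->
    exists2 v, K v & expect (fun x => f x ^+ 4) / expect (fun x => f x ^+ 2) ^+ 2 = q4 v.
  move=> [x fx] fA; have Ef := expect_sq_gt0 fx.
  set e := expect (fun x => f x ^+ 2) in Ef *.
  pose c := (Num.sqrt e)^-1.
  have c2 : c ^+ 2 = e^-1 by rewrite exprVn sqr_sqrtr // ltW.
  have expc m : expect (fun x => (c * f x) ^+ m) = c ^+ m * expect (fun x => f x ^+ m).
    rewrite /expect mulrA mulr_sumr; congr (_ / _).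
    by apply: eq_bigr => y _; rewrite exprMn.
  exists (row_of_fun (fun x => c * f x)); last first.
    rewrite /q4 row_of_funK expc mulrC; congr (_ * _).
    by rewrite -exprVn -c2 -exprM.
  apply/KE; rewrite /sq row_of_funK; split.
    by rewrite expc c2 mulVf // gt_eqF.
  move=> a aA; transitivity (c * fourier f a); last by rewrite fA ?mulr0.
  rewrite /fourier /expect mulrA mulr_sumr; congr (_ / _).
  by apply: eq_bigr => y _; rewrite mulrA.
have ratioK v : K v -> mu_ratios R A (q4 v).
  move=> /KE[v1 vA]; exists (fun_of_row v) => /=; last first.
    by move: v1; rewrite /sq => ->; rewrite expr1n divr1.
  split=> //; apply/existsP; apply: contra_eqT v1 => /existsPn v0.
  rewrite /sq /expect big1 ?mul0r 1?eq_sym ?oner_eq0 // => x _.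
  by have := v0 x; rewrite negbK => /eqP ->; rewrite expr0n.
have [v0 Kv0 _] : exists2 v, K v & expect (fun x => walsh R a0 x ^+ 4) /
    expect (fun x => walsh R a0 x ^+ 2) ^+ 2 = q4 v.
  apply: scale; first by exists 0; rewrite signr_eq0.
  by move=> a aA; rewrite fourier_walsh; case: eqP aA => // <-; rewrite a0A.
have [c /set_mem Kc cmax] : exists2 c, c \in K & forall t, t \in K -> q4 t <= q4 c.
  apply: EVT_max_rV; first by exists v0.
    exact: bounded_closed_compact.
  exact/continuous_subspaceT/exp_cont.
have ubc : ubound (mu_ratios R A) (q4 c).
  by move=> _ [f [f0 fA] <-]; have [v Kv ->] := scale f f0 fA; exact/cmax/mem_set.
suff -> : mu R A = q4 c by split=> //; exact: ratioK.
apply/eqP; rewrite eq_le; apply/andP; split.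
  by apply: ge_sup => //; exists (q4 c); exact: ratioK.
by apply: ub_le_sup; [exists (q4 c)|exact: ratioK].
Qed.
End Fourier.

Lemma slice_neq0 (n k : nat) : (k <= n)%N -> slice n k != finset.set0.
Proof.
move=> kn; apply/set0Pn; exists (\row_(i < n) (i < k)%N%:R); rewrite inE.
rewrite (eq_bigr (fun i : 'I_n => nat_of_bool (i < k)%N)); last first.
  by move=> i _; rewrite mxE; case: ltnP.
rewrite -(big_mkord xpredT (fun i => nat_of_bool (i < k)%N)) (big_cat_nat _ kn) //=.
rewrite [X in (X + _)%N](eq_big_nat _ _ (F2 := fun=> 1%N)); last first.
  by move=> i /= ->.
rewrite [X in (_ + X)%N]big_nat_cond [X in (_ + X)%N]big1.
  by rewrite addn0 sum_nat_const_nat subn0 muln1.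
by move=> i /andP[/andP[ki _] _]; rewrite ltnNge ki.
Qed.

(* Main.v *)
Require Import Defs.
From mathcomp Require Import all_boot all_order all_algebra.
From mathcomp Require Import all_classical all_reals all_analysis.
From mathcomp Require Import ring lra zify.

Import Order.TTheory GRing.Theory Num.Theory.

Set Implicit Arguments.
Unset Strict Implicit.
Unset Printing Implicit Defensive.

Local Open Scope ring_scope.

(* Upper bound: whenever u, v >= 1 lie on the curve u^2 + v^2 + 8 = 6uv, the
   two-point inequality a^2 + 6ab + b^2 <= (ua + vb)^2 holds for a, b >= 0, and
   it tensorizes to E f^4 <= (u^(n-k) v^k)^2 (E f^2)^2 for f with spectrum in
   S(n,k).  With r = r(x), the best choice for x = k/n is
   u = sqrt(1-2r) (1-x)/(1-x-r), v = sqrt(1-2r) x/(x-r), and since r is a root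
   of 2(x-r)(1-x-r) = r(1-2r), the bound equals 2^(n psi(x)).

   Lower bound: the quadruples of S(n,k) with |a+b| = 2j number at least
   C(n,2j) (C(2j,j) C(n-2j,k-j))^2.  Stirling's formula loses a factor k^(3/2)
   against the exponential rate at j/n, and rounding the maximizer nr down to
   an integer j changes the exponent only by a bounded amount. *)

(** * The fourth moment inequality *)

(** The curve equation is equivalent to (uv - 3)^2 = (u^2 - 1)(v^2 - 1). The difference of the two
    sides is thus a quadratic form in [a], [b] with zero discriminant, and u^2 - 1 times it is a
    perfect square. *)
Lemma quad_le_sqr (R : realFieldType) (u v a b : R) :
  1 <= u -> 1 <= v -> u ^+ 2 + v ^+ 2 + 8 = 6 * u * v -> 0 <= a -> 0 <= b ->
  a ^+ 2 + 6 * (a * b) + b ^+ 2 <= (u * a + v * b) ^+ 2.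
Proof.
(* At [u = 1] the multiplier u^2 - 1 vanishes, but there the curve equation reads (v - 3)^2 = 0. *)
rewrite le_eqVlt => /orP[/eqP<- _ uv a0 b0|u1 v1 uv a0 b0].
  have -> : v = 3.
    by apply/eqP; rewrite -subr_eq0 -sqrf_eq0; apply/eqP; lra.
  nra.
have u2 : 0 < u ^+ 2 - 1 by nra.
have uE : u ^+ 2 = 6 * u * v - v ^+ 2 - 8 by rewrite -uv; ring.
rewrite -subr_ge0 -(pmulr_rge0 _ u2).
have -> : (u ^+ 2 - 1) * ((u * a + v * b) ^+ 2 - (a ^+ 2 + 6 * (a * b) + b ^+ 2))
  = ((u ^+ 2 - 1) * a + (u * v - 3) * b) ^+ 2 by ring: uE.
exact: sqr_ge0.
Qed.

Definition cube_cons {n : nat} (b : 'F_2) (x : cube n) : cube n.+1 :=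
  \row_i oapp (x 0) b (unlift ord0 i).

Lemma cube_cons0 n b (x : cube n) : cube_cons b x 0 ord0 = b.
Proof. by rewrite mxE unlift_none. Qed.

Lemma cube_consS n b (x : cube n) i : cube_cons b x 0 (lift ord0 i) = x 0 i.
Proof. by rewrite mxE liftK. Qed.

Lemma sum_cubeS (V : nmodType) n (F : cube n.+1 -> V) :
  \sum_x F x = \sum_(x : cube n) (F (cube_cons 0 x) + F (cube_cons 1 x)).
Proof.
rewrite (reindex (fun p : 'F_2 * cube n => cube_cons p.1 p.2)); last first.
  exists (fun x : cube n.+1 => (x 0 ord0, \row_i x 0 (lift ord0 i))) => [[b x]|x] _ /=.
    rewrite cube_cons0; congr pair; apply/rowP => i.
    by rewrite mxE cube_consS.
  apply/rowP => i; case: (unliftP ord0 i) => [j ->|->].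
    by rewrite cube_consS mxE.
  by rewrite cube_cons0.
rewrite -(pair_bigA _ (fun b x => F (cube_cons b x))) exchange_big /=.
apply: eq_bigr => x _.
by rewrite (bigD1 0) //= (bigD1 1) //= big1 ?addr0 // => -[[|[|m]] im].
Qed.

Lemma walsh_cons (R : realType) n (b d : 'F_2) (a x : cube n) :
  walsh R (cube_cons b a) (cube_cons d x) = (-1) ^+ (b * d)%N * walsh R a x.
Proof.
rewrite /walsh big_ord_recl !cube_cons0 exprD; congr (_ * _ ^+ _).
by apply: eq_bigr => i _; rewrite !cube_consS.
Qed.

Lemma card_cubeS n : #|{: cube n.+1}| = (2 * #|{: cube n}|)%N.
Proof. by rewrite !card_mx card_Fp // !mul1n expnS. Qed.

Definition cube_weight {R : realType} (u v : R) {n} (a : cube n) : R :=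
  \prod_i (if a 0 i == 0 then u else v).

Lemma cube_weight_cons (R : realType) (u v : R) n b (a : cube n) :
  cube_weight u v (cube_cons b a) = (if b == 0 then u else v) * cube_weight u v a.
Proof.
rewrite /cube_weight big_ord_recl cube_cons0; congr (_ * _).
by apply: eq_bigr => i _; rewrite !cube_consS.
Qed.

Section Moments.
Variables (R : realType) (n : nat).
Implicit Types (f g : cube n -> R).

Lemma expectD f g : expect (fun x => f x + g x) = expect f + expect g.
Proof. by rewrite /expect big_split mulrDl. Qed.

Lemma expectZ c f : expect (fun x => c * f x) = c * expect f.
Proof. by rewrite /expect -mulr_sumr mulrA. Qed.

Lemma card_cube_gt0 : 0 < #|{: cube n}|%:R :> R.
Proof. by rewrite lt0r card_cube_neq0 ler0n. Qed.

Lemma ler_expect f g : (forall x, f x <= g x) -> expect f <= expect g.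
Proof.
move=> fg; rewrite /expect ler_pM2r ?invr_gt0 ?card_cube_gt0 //.
exact: ler_sum.
Qed.

Lemma expect_eq0 f : (forall x, 0 <= f x) -> expect f <= 0 -> forall x, f x = 0.
Proof.
move=> f0; rewrite /expect pmulr_lle0 ?invr_gt0 ?card_cube_gt0 // => s0 x.
have /psumr_eq0P : \sum_x f x = 0.
  by apply/eqP; rewrite eq_le s0 sumr_ge0 // => *; exact: f0.
by apply => // *; exact: f0.
Qed.

(** Cauchy-Schwarz for f^2 and g^2 without square roots: average (b f^2 - a g^2)^2 >= 0 and divide
    by 2ab. *)
Lemma expect_sqM_le f g a b : 0 <= a -> 0 <= b ->
  expect (fun x => f x ^+ 4) <= a ^+ 2 -> expect (fun x => g x ^+ 4) <= b ^+ 2 ->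
  expect (fun x => f x ^+ 2 * g x ^+ 2) <= a * b.
Proof.
(* When [a] or [b] is 0 there is nothing to divide by, but a vanishing fourth moment makes the
   function vanish pointwise. *)
have E0 (h h' : cube n -> R) : expect (fun x => h x ^+ 4) <= 0 ->
    expect (fun x => h x ^+ 2 * h' x ^+ 2) <= 0.
  move=> h0; have hx x : h x = 0.
    have h4 y : 0 <= h y ^+ 4 by rewrite exprn_even_ge0.
    have := @expect_eq0 (fun x => h x ^+ 4) h4 h0 x.
    by move/eqP; rewrite expf_eq0 => /eqP.
  by rewrite /expect big1 ?mul0r // => x _; rewrite hx expr0n mul0r.
rewrite le_eqVlt => /orP[/eqP<- _|a0].
  by rewrite expr0n mul0r => /E0.
rewrite le_eqVlt => /orP[/eqP<- _|b0 fa gb].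
  rewrite expr0n mulr0 => /(E0 _ f); congr (_ <= _); congr expect.
  by apply/funext => x; rewrite mulrC.
have ab : 0 < 2 * (a * b) by rewrite !mulr_gt0.
rewrite -(ler_pM2l ab) -expectZ.
apply: (@le_trans _ _ (expect (fun x => b ^+ 2 * f x ^+ 4 + a ^+ 2 * g x ^+ 4))).
  apply: ler_expect => x; rewrite -subr_ge0.
  have -> : b ^+ 2 * f x ^+ 4 + a ^+ 2 * g x ^+ 4 - 2 * (a * b) * (f x ^+ 2 * g x ^+ 2)
     = (b * f x ^+ 2 - a * g x ^+ 2) ^+ 2 by ring.
  exact: sqr_ge0.
rewrite expectD !expectZ.
have h1 := ler_wpM2l (sqr_ge0 b) fa.
have h2 := ler_wpM2l (sqr_ge0 a) gb.
by apply: (le_trans (lerD h1 h2)); rewrite le_eqVlt; apply/orP; left; apply/eqP; ring.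
Qed.

Lemma parseval f : expect (fun x => f x ^+ 2) = \sum_a fourier f a ^+ 2.
Proof.
transitivity (expect (fun x => \sum_a fourier f a * (f x * walsh R a x))).
  congr expect; apply/funext => x; rewrite expr2 {1}(fourier_inversion f x) mulr_suml.
  by apply: eq_bigr => a _; rewrite -mulrA (mulrC (walsh _ _ _)).
rewrite /expect exchange_big /= mulr_suml; apply: eq_bigr => a _.
by rewrite -mulr_sumr -mulrA expr2.
Qed.

Lemma cube_weight_ge0 (u v : R) (a : cube n) : 0 <= u -> 0 <= v -> 0 <= cube_weight u v a.
Proof. by move=> u0 v0; apply: prodr_ge0 => i _; case: ifP. Qed.

Lemma cube_weight_slice (u v : R) k (a : cube n) :
  a \in slice n k -> cube_weight u v a = u ^+ (n - k) * v ^+ k.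
Proof.
rewrite inE => /eqP ak.
have aE i : a 0 i = (a 0 i != 0) :> nat by case: (a 0 i) => [[|[|m]] im].
have kE : k = #|[pred i | a 0 i != 0]|.
  by rewrite -ak -sum1_card [RHS]big_mkcond; apply: eq_bigr => i _; rewrite aE inE; case: (_ != _).
rewrite /cube_weight (bigID (fun i => a 0 i == 0)) /=; congr (_ * _).
  rewrite (eq_bigr (fun=> u)) => [|i ->] //.
  rewrite prodr_const kE -[X in (X - _)%N]card_ord -(cardC [pred i | a 0 i != 0]) addKn.
  by congr (_ ^+ _); apply: eq_card => i; rewrite !inE negbK.
rewrite (eq_bigr (fun=> v)) => [|i /negPf->] //.
by rewrite prodr_const kE.
Qed.

End Moments.

(* The two-point inequality [quad_le_sqr] tensorizes: splitting off one
   coordinate writes the polynomial as g + e h with a random sign e, and the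
   mixed moment of g and h is bounded by Cauchy-Schwarz. *)
Lemma fourth_moment_le (R : realType) (u v : R) : 1 <= u -> 1 <= v ->
  u ^+ 2 + v ^+ 2 + 8 = 6 * u * v -> forall n (c : cube n -> R),
  expect (fun x => (\sum_a c a * walsh R a x) ^+ 4) <=
  (\sum_a cube_weight u v a * c a ^+ 2) ^+ 2.
Proof.
move=> u1 v1 uv; have u0 := le_trans ler01 u1; have v0 := le_trans ler01 v1.
elim=> [|n IH] c.
  have W0 (F : cube 0 -> R) : \sum_a F a = F 0.
    by rewrite (bigD1 0) //= big1 ?addr0 // => a; rewrite thinmx0 eqxx.
  rewrite /expect !W0 /walsh /cube_weight !big_ord0 card_mx muln0 expn0 divr1.
  by rewrite expr0 mulr1 mul1r -exprM.
pose g b x := \sum_a c (cube_cons b a) * walsh R a x.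
pose A b := \sum_(a : cube n) cube_weight u v a * c (cube_cons b a) ^+ 2.
have A0 b : 0 <= A b.
  by apply: sumr_ge0 => a _; rewrite mulr_ge0 ?sqr_ge0 ?cube_weight_ge0.
have -> : \sum_a cube_weight u v a * c a ^+ 2 = u * A 0 + v * A 1.
  rewrite sum_cubeS big_split /= !mulr_sumr.
  by congr (_ + _); apply: eq_bigr => a _; rewrite cube_weight_cons /= mulrA.
apply: (le_trans _ (quad_le_sqr u1 v1 uv (A0 0) (A0 1))).
(* Averaging over the first coordinate cancels the odd powers in the expansion of (g 0 ± g 1)^4,
   leaving the coefficients 1, 6, 1. *)
have -> : expect (fun x => (\sum_a c a * walsh R a x) ^+ 4) =
    expect (fun x => g 0 x ^+ 4) + 6 * expect (fun x => g 0 x ^+ 2 * g 1 x ^+ 2)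
    + expect (fun x => g 1 x ^+ 4).
  rewrite -expectZ -!expectD /expect card_cubeS natrM invfM mulrA; congr (_ / _).
  rewrite sum_cubeS mulr_suml; apply: eq_bigr => x _.
  have gE d : \sum_a c a * walsh R a (cube_cons d x) = g 0 x + (-1) ^+ d * g 1 x.
    rewrite sum_cubeS big_split /= !mulr_sumr; congr (_ + _); apply: eq_bigr => a _.
      by rewrite walsh_cons /= mul0n mul1r.
    by rewrite walsh_cons /= mul1n mulrCA.
  by rewrite !gE /= expr0 expr1; field.
apply: lerD; last exact: IH.
apply: lerD; first exact: IH.
by rewrite ler_pM2l // expect_sqM_le //; exact: IH.
Qed.

(** The weight is constant on a slice, so for a spectrum inside the slice the weighted sum of
    squared coefficients is, by Parseval, that constant times the second moment. *)
Lemma mu_slice_le (R : realType) (u v : R) n k : (k <= n)%N -> 1 <= u -> 1 <= v ->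
  u ^+ 2 + v ^+ 2 + 8 = 6 * u * v ->
  mu R (slice n k) <= (u ^+ (n - k) * v ^+ k) ^+ 2.
Proof.
move=> kn u1 v1 uv.
(* The supremum is attained, so it suffices to bound the ratio of one extremal [f]. *)
have [[f [[x fx] fA] <-] _] := mu_max R (slice_neq0 kn).
rewrite ler_pdivrMr ?exprn_gt0 //; last exact: expect_sq_gt0 fx.
rewrite -exprMn parseval mulr_sumr.
have := fourth_moment_le u1 v1 uv (fourier f).
under [X in X ^+ 2]eq_bigr => a _.
  have -> : cube_weight u v a * fourier f a ^+ 2 = u ^+ (n - k) * v ^+ k * fourier f a ^+ 2.
    have [/cube_weight_slice-> //|/fA->] := boolP (a \in slice n k).
    by rewrite expr0n !mulr0.
  over.
congr (_ <= _); congr expect; apply/funext => y.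
by rewrite -fourier_inversion.
Qed.

(** * Additive energy of a slice *)

(** Passing to supports turns slices into families of subsets of fixed size, which binomial
    coefficients count. *)
Definition cube_of_set {n : nat} (X : {set 'I_n}) : cube n :=
  \row_i (i \in X)%:R.

Lemma cube_of_set_inj n : injective (@cube_of_set n).
Proof.
move=> X Y /rowP XY; apply/finset.setP => i; have := XY i.
by rewrite !mxE; case: (i \in X); case: (i \in Y).
Qed.

Lemma cube_of_setK n (x : cube n) :
  cube_of_set [set i | x 0 i != 0]%SET = x.
Proof.
apply/rowP => i; rewrite mxE inE.
by case: (x 0 i) => [[|[|//]] im]; apply: val_inj.
Qed.

Lemma cube_of_set_slice n k (X : {set 'I_n}) :
  (cube_of_set X \in slice n k) = (#|X| == k).
Proof.
rewrite inE -sum1_card [in RHS]big_mkcond /=; congr (_ == _).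
by apply: eq_bigr => i _; rewrite mxE; case: ifP.
Qed.

Lemma cube_of_setD n (X Z : {set 'I_n}) :
  cube_of_set X + cube_of_set Z = cube_of_set ((X :\: Z) :|: (Z :\: X))%SET.
Proof.
apply/rowP => i; rewrite !mxE !inE.
by case: (i \in X); case: (i \in Z) => /=; apply: val_inj.
Qed.

Lemma card_slice n k : #|slice n k| = 'C(n, k).
Proof.
rewrite -[in RHS](card_ord n) -card_draws -(card_imset _ (@cube_of_set_inj n)).
apply: eq_card => x; apply/idP/imsetP => [xk|[X]].
  exists [set i | x 0 i != 0]%SET; last by rewrite cube_of_setK.
  by rewrite inE -cube_of_set_slice cube_of_setK.
by rewrite inE => Xk ->; rewrite cube_of_set_slice.
Qed.

(** Choose j of the 2j positions in [Z] and k - j positions outside. Adding the indicator of [Z]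
    complements the part inside, which keeps size j, and leaves the rest alone. *)
Lemma leq_card_slice_shift n k j (Z : {set 'I_n}) : (j <= k)%N -> #|Z| = (2 * j)%N ->
  ('C(2 * j, j) * 'C(n - 2 * j, k - j) <=
   #|[set a in slice n k | (a + cube_of_set Z)%R \in slice n k]%SET|)%N.
Proof.
move=> jk Zj.
have CZ : #|(~: Z)%SET| = (n - 2 * j)%N by rewrite cardsCs finset.setCK card_ord Zj.
rewrite -{1}Zj -CZ -!cards_draws -cardsX.
pose F (p : {set 'I_n} * {set 'I_n}) := cube_of_set (p.1 :|: p.2).
rewrite -(@card_in_imset _ _ F) => [|[X Y] [X' Y']]; last first.
  rewrite !inE /= => /andP[/andP[XZ _] /andP[YZ _]] /andP[/andP[XZ' _] /andP[YZ' _]].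
  move/cube_of_set_inj/finset.setP => E.
  (* Intersecting the union with [Z] and with its complement recovers both parts, whence
     injectivity. *)
  have dis (U V : {set 'I_n}) i : U \subset Z -> V \subset (~: Z)%SET ->
     ((i \in U) = (i \in U :|: V) && (i \in Z)) /\ ((i \in V) = (i \in U :|: V) && (i \notin Z)).
    move=> /fintype.subsetP /(_ i) /implyP + /fintype.subsetP /(_ i) /implyP.
    by rewrite !inE; case: (i \in U); case: (i \in V); case: (i \in Z).
  congr pair; apply/finset.setP => i.
    by have [-> _] := dis _ _ i XZ YZ; have [-> _] := dis _ _ i XZ' YZ'; rewrite E.
  by have [_ ->] := dis _ _ i XZ YZ; have [_ ->] := dis _ _ i XZ' YZ'; rewrite E.
apply/subset_leq_card/fintype.subsetP => _ /imsetP[[X Y] + ->].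
case/setXP => /=; rewrite inE => /andP[XZ /eqP Xj]; rewrite inE => /andP[YZ /eqP Yj].
rewrite inE.
have YZ' : [disjoint Y & Z] by rewrite finset.disjoints_subset.
have XYd : [disjoint X & Y].
  by rewrite disjoint_sym; exact: fintype.disjointWr XZ YZ'.
rewrite /F /= cube_of_setD !cube_of_set_slice.
have -> : ((X :|: Y) :\: Z :|: Z :\: (X :|: Y) = Y :|: Z :\: X)%SET.
  apply/finset.setP => i; rewrite !inE.
  have /implyP := fintype.subsetP XZ i; have /implyP := fintype.subsetP YZ i.
  by rewrite inE; case: (i \in X); case: (i \in Y); case: (i \in Z).
rewrite !cardsU.
have -> : (X :&: Y = finset.set0)%SET by apply/eqP; rewrite setI_eq0.
have -> : (Y :&: (Z :\: X) = finset.set0)%SET.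
  apply/eqP; rewrite setI_eq0; apply: fintype.disjointWr YZ'; exact: subsetDl.
rewrite cards0 !subn0 cardsD (finset.setIidPr XZ) Zj Xj Yj mul2n -addnn addnK subnKC // subnK //.
by rewrite eqxx.
Qed.

(** In characteristic 2 the quadruple (a, a + z, c, c + z) sums to zero. Each [z] of weight 2j
    admits |N z|^2 pairs (a, c), and the first two entries determine [z]. *)
Lemma E2_slice_ge n k j : (j <= k)%N ->
  ('C(n, 2 * j) * ('C(2 * j, j) * 'C(n - 2 * j, k - j)) ^ 2 <= E2 (slice n k))%N.
Proof.
move=> jk.
pose N (z : cube n) := [set a in slice n k | (a + z)%R \in slice n k]%SET.
pose D := [set t : cube n * cube n * cube n |
  [&& t.1.1 \in slice n (2 * j), t.1.2 \in N t.1.1 & t.2 \in N t.1.1]]%SET.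
have cube2 (z : cube n) : z + z = 0.
  by apply/rowP => i; rewrite !mxE; case: (z 0 i) => [[|[|//]] im]; apply: val_inj.
apply: (@leq_trans #|D|).
  have -> : #|D| = (\sum_(z in slice n (2 * j)) #|N z| ^ 2)%N.
    rewrite -sum1_card (eq_bigl (fun t : cube n * cube n * cube n =>
      (t.1.1 \in slice n (2 * j)) && (t.1.2 \in N t.1.1) && (t.2 \in N t.1.1))); last first.
      by move=> t; rewrite inE andbA.
    rewrite -(pair_big_dep (fun p : cube n * cube n =>
       (p.1 \in slice n (2 * j)) && (p.2 \in N p.1)) (fun p c => c \in N p.1) (fun _ _ => 1%N)) /=.
    rewrite -(pair_big_dep (fun z => z \in slice n (2 * j)) (fun z a => a \in N z)
      (fun z _ => \sum_(c in N z) 1)%N) /=.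
    by apply: eq_bigr => z _; rewrite sum1_card sum_nat_const.
  rewrite -card_slice -sum_nat_const; apply: leq_sum => z zj.
  rewrite leq_sqr /N -(cube_of_setK z); apply: leq_card_slice_shift => //.
  by apply/eqP; rewrite -cube_of_set_slice cube_of_setK.
pose F (t : cube n * cube n * cube n) := (t.1.2, t.1.2 + t.1.1, t.2, t.2 + t.1.1).
rewrite -(@card_imset _ _ F D) => [|[[z a] c] [[z' a'] c'] [-> + -> _]]; last first.
  by move/addrI->.
apply/subset_leq_card/fintype.subsetP => _ /imsetP[[[z a] c] + ->].
rewrite finset.in_set /= => /and3P[_].
rewrite finset.in_set => /andP[a1 a2]; rewrite finset.in_set => /andP[c1 c2].
rewrite finset.in_set /= a1 a2 c1 c2 /=.
by rewrite (addrA a a) cube2 add0r -addrA (addrA c c) cube2 add0r cube2.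
Qed.

(** * Logarithms, factorials and the exponent *)

Lemma le_of_derive_ge0 (R : realType) (f df : R -> R) (a : R) :
  (forall t, a <= t -> is_derive t 1 f (df t)) ->
  (forall t, a <= t -> 0 <= df t) -> forall t, a <= t -> f a <= f t.
Proof.
move=> fd df0 t at_.
apply: (@ger0_derive1_ndecr _ f a t) => // [x|x|].
- by rewrite in_itv /= => /andP[/ltW ax _]; have [] := fd x ax.
- rewrite in_itv /= => /andP[/ltW ax _]; rewrite derive1E.
  by have := fd x ax => dfx; rewrite derive_val; exact: df0.
- apply: derivable_within_continuous => x.
  by rewrite in_itv /= => /andP[ax _]; have [] := fd x ax.
Qed.

Section LnBounds.
Variable R : realType.
Implicit Types (t p q : R).

Lemma ln_le_subr1 t : 0 < t -> ln t <= t - 1.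
Proof. by move=> t0; rewrite -{1}(subrKC 1 t) le_ln1Dx // ltrBrDl subrr. Qed.

Lemma ln_ge_1subV t : 0 < t -> 1 - t^-1 <= ln t.
Proof.
move=> t0; have := @ln_le_subr1 t^-1; rewrite invr_gt0 => /(_ t0).
by rewrite lnV ?posrE //; lra.
Qed.

(** At t = (m + 1)/m this reads (m + 1/2) ln(1 + 1/m) >= 1, which makes the Stirling error
    nonincreasing. *)
Lemma ln_ge_pade t : 1 <= t -> 2 * (t - 1) <= (t + 1) * ln t.
Proof.
pose f t := (t + 1) * ln t - 2 * (t - 1) : R.
move=> t1; rewrite -subr_ge0.
have <- : f 1 = 0 by rewrite /f ln1 subrr !mulr0 subrr.
apply: (@le_of_derive_ge0 _ f (fun t => ln t + t^-1 - 1)) t1 => s s1;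
  have s0 : 0 < s := lt_le_trans ltr01 s1.
  have ds := is_derive1_ln s0.
  rewrite /f; apply: is_derive_eq.
  rewrite /GRing.scale /=; field.
  by rewrite gt_eqF.
by have := ln_ge_1subV s0; lra.
Qed.

(** The trapezoid rule for the integral of 1/s over [1, t] overestimates, since 1/s is convex. This
    limits how fast the Stirling error can decrease. *)
Lemma ln_le_trapezoid t : 1 <= t -> 2 * t * ln t <= t ^+ 2 - 1.
Proof.
pose f t := t * t - 1 - 2 * t * ln t : R.
move=> t1; rewrite -subr_ge0 expr2.
have <- : f 1 = 0 by rewrite /f ln1 !mulr0 subr0 mulr1 subrr.
apply: (@le_of_derive_ge0 _ f (fun t => 2 * t - 2 * ln t - 2)) t1 => s s1;
  have s0 : 0 < s := lt_le_trans ltr01 s1.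
  have ds := is_derive1_ln s0.
  rewrite /f; apply: is_derive_eq.
  rewrite /GRing.scale /=; field.
  by rewrite gt_eqF.
by have := ln_le_subr1 s0; lra.
Qed.

Lemma mulr_lnB_le p q : 0 <= p -> 0 < q -> p * (ln q - ln p) <= q - p.
Proof.
rewrite le_eqVlt => /orP[/eqP<-|p0] q0; first by rewrite mul0r subr0 ltW.
rewrite -ln_div ?posrE // -(ler_pM2l (_ : 0 < p^-1)) ?invr_gt0 //.
rewrite mulKf ?gt_eqF // mulrBr mulVf ?gt_eqF // (mulrC p^-1).
by apply: ln_le_subr1; rewrite divr_gt0.
Qed.

(** The left side is at most (p/q)(p - q), where p/q <= 1 + 1/q <= 4 and p - q <= 1. *)
Lemma mulr_lnB_le4 p q : q <= p -> 3^-1 <= q -> p <= q + 1 -> p * (ln p - ln q) <= 4.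
Proof.
move=> qp q3 pq; have q0 : 0 < q by lra.
have p0 : 0 < p by lra.
have := mulr_lnB_le (ltW q0) p0; rewrite -(ler_pM2l (_ : 0 < p / q)) ?divr_gt0 //.
rewrite mulrA divfK ?gt_eqF // => /le_trans; apply.
rewrite mulrAC ler_pdivrMr //; nra.
Qed.

(* Stirling's formula with the constant [ln (2 pi) / 2] left undetermined:
   the error term [d m] decreases by at most [1 / (4 m) - 1 / (4 (m + 1))]
   from [m] to [m + 1]. *)
Lemma ln_fact_bounds (m : nat) (M := (maxn 1 m)%:R : R) :
  m%:R * ln m%:R - m%:R + ln M / 2 <= ln (m`!%:R : R)
    <= m%:R * ln m%:R - m%:R + ln M / 2 + 1.
Proof.
(* At [m = 0] the factor 0 removes [ln 0], and [maxn] turns the half-logarithm into [ln 1]. *)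
rewrite {}/M; case: m => [|m]; first by rewrite fact0 maxn0 ln1 !mul0r; apply/andP; split; lra.
rewrite (maxn_idPr _) //.
pose d (m : nat) : R := ln (m`!%:R) - m%:R * ln m%:R + m%:R - ln m%:R / 2.
(* The extra term in the lower bound is the decrease still allowed, which makes the induction
   telescope. It starts from d 1 = 1 = 3/4 + 1/4. *)
suff : 3 / 4 + (4 * m.+1%:R)^-1 <= d m.+1 <= 1.
  have : 0 < (4 * m.+1%:R)^-1 :> R by rewrite invr_gt0 mulr_gt0.
  rewrite /d; move: (ln _) (ln _) (_^-1) => lf la i i0 /andP[h1 h2].
  by apply/andP; split; lra.
elim: m => [|m]; first by rewrite /d factS fact0 muln1 ln1; apply/andP; split; lra.
set a : R := m.+1%:R => IH.
have a0 : 0 < a by rewrite ltr0n.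
have aS : m.+2%:R = a + 1 :> R by rewrite -natr1.
have a1 : 0 < a + 1 by lra.
have t1 : 1 <= (a + 1) / a by rewrite ler_pdivlMr //; lra.
have dS : d m.+2 = d m.+1 + 1 - (a + 2^-1) * ln ((a + 1) / a).
  rewrite /d factS natrM lnM ?posrE ?ltr0n ?fact_gt0 // ln_div ?posrE // aS -/a.
  by field.
have lo := ln_ge_pade t1; have hi := ln_le_trapezoid t1.
set l := ln ((a + 1) / a) in dS lo hi.
have lo' : 1 <= (a + 2^-1) * l.
  have := ler_wpM2l (ltW a0) lo.
  have -> : a * (2 * ((a + 1) / a - 1)) = 2 by field; rewrite gt_eqF.
  have -> : a * (((a + 1) / a + 1) * l) = (2 * a + 1) * l by field; rewrite gt_eqF.
  lra.
have hi' : (a + 2^-1) * l <= 1 + (4 * a)^-1 - (4 * (a + 1))^-1.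
  have c0 : 0 <= (a + 2^-1) * a / (2 * (a + 1)) by rewrite divr_ge0 ?mulr_ge0 //; lra.
  have := ler_wpM2l c0 hi.
  have -> : (a + 2^-1) * a / (2 * (a + 1)) * (2 * ((a + 1) / a) * l) = (a + 2^-1) * l.
    by field; rewrite !gt_eqF.
  have -> // : (a + 2^-1) * a / (2 * (a + 1)) * (((a + 1) / a) ^+ 2 - 1)
     = 1 + (4 * a)^-1 - (4 * (a + 1))^-1.
  by field; rewrite !gt_eqF.
rewrite dS aS; move: IH lo' hi'.
move: (d m.+1) ((a + 2^-1) * l) ((4 * a)^-1) ((4 * (a + 1))^-1) => D e i i'.
by move=> /andP[? ?] ? ?; apply/andP; split; lra.
Qed.

Lemma ln_bin (n m : nat) : (m <= n)%N ->
  ln ('C(n, m)%:R : R) = ln n`!%:R - ln m`!%:R - ln (n - m)`!%:R.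
Proof.
move=> mn; rewrite -(bin_fact mn) !natrM !lnM ?posrE ?mulr_gt0 ?ltr0n ?bin_gt0 ?fact_gt0 //.
by ring.
Qed.

End LnBounds.

(** * The critical point of the exponent and the cost of rounding it *)

Section Exponent.
Variable R : realType.
Implicit Types x r : R.

(** [rfun x] is the smaller root of the quadratic; the bounds follow by comparing squares with the
    discriminant. The bound 2x/3 later keeps k - nr >= 1/3 for k >= 1. *)
Lemma rfunP x (r := rfun x) : 0 < x <= 2^-1 ->
  [/\ 4 * r ^+ 2 - 3 * r + 2 * (x * (1 - x)) = 0, 0 < r, r <= 2 / 3 * x & r <= 4^-1].
Proof.
move=> /andP[x0 x2]; rewrite {}/r /rfun.
have q0 : 0 <= 1 + 8 * (1 - 2 * x) ^+ 2 by nra.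
have s2 := sqr_sqrtr q0; have s0 := sqrtr_ge0 (1 + 8 * (1 - 2 * x) ^+ 2).
set s := Num.sqrt _ in s2 s0 *.
split.
- have -> : 4 * ((3 - s) / 8) ^+ 2 - 3 * ((3 - s) / 8) = (s ^+ 2 - 9) / 16 by field.
  by rewrite s2; field.
- have : s < 3 by rewrite -(ltr_pXn2r (_ : 0 < 2)%N) ?nnegrE // s2; nra.
  by lra.
- have : 3 - 16 / 3 * x <= s.
    have x3 : 0 <= 3 - 16 / 3 * x by lra.
    by rewrite -(ler_pXn2r (_ : 0 < 2)%N) ?nnegrE // s2; nra.
  by lra.
- have : 1 <= s by rewrite -(ler_pXn2r (_ : 0 < 2)%N) ?nnegrE // s2; nra.
  by lra.
Qed.

Lemma entropyM_ln2 (p : R) : entropy p * ln 2 = - p * ln p - (1 - p) * ln (1 - p).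
Proof.
have : ln (2 : R) != 0 by rewrite gt_eqF // ln_gt0 // ltr1n.
by rewrite /entropy /log2 => ?; field.
Qed.

(** The quadratic of [rfunP], rearranged so that taking logarithms gives the vanishing of the
    derivative of the exponent in r. *)
Lemma rfun_critical x (r := rfun x) : 0 < x <= 2^-1 ->
  2 * ((x - r) * (1 - x - r)) = r * (1 - 2 * r).
Proof. by rewrite {}/r => /rfunP[]; move: (rfun x) => r ? _ _ _; lra. Qed.

(* As [rfun x] is a critical point of the exponent, the coefficient of [rfun x]
   in [psi x] vanishes. *)
Lemma psiM_ln2 x (r := rfun x) : 0 < x <= 2^-1 ->
  psi x * ln 2 = ln (1 - 2 * r) + 2 * x * (ln x - ln (x - r))
    + 2 * (1 - x) * (ln (1 - x) - ln (1 - x - r)).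
Proof.
move=> xI; have := rfun_critical xI; have := rfunP xI; rewrite {}/r /psi; cbv zeta.
move: (rfun x) => r [_ r0 rx r4].
move: xI => /andP[x0 x2] /(congr1 (@ln R)).
have [q1 q2 q3] : [/\ 0 < x - r, 0 < 1 - x - r & 0 < 1 - 2 * r] by split; lra.
rewrite !lnM ?posrE ?mulr_gt0 // => crit.
transitivity (entropy (2 * r) * ln 2 + 4 * r * ln 2
  + 2 * ((1 - 2 * r) * (entropy ((x - r) / (1 - 2 * r)) * ln 2)) - 2 * (entropy x * ln 2)).
  by ring.
rewrite !entropyM_ln2.
have -> : 1 - (x - r) / (1 - 2 * r) = (1 - x - r) / (1 - 2 * r) by field; rewrite gt_eqF.
rewrite !ln_div ?posrE // (@lnM _ 2) ?posrE //.
have -> : (1 - 2 * r) * (- ((x - r) / (1 - 2 * r)) * (ln (x - r) - ln (1 - 2 * r)) -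
       (1 - x - r) / (1 - 2 * r) * (ln (1 - x - r) - ln (1 - 2 * r)))
  = - (x - r) * (ln (x - r) - ln (1 - 2 * r)) - (1 - x - r) * (ln (1 - x - r) - ln (1 - 2 * r)).
  by field; rewrite gt_eqF.
have -> : ln (1 - x - r) = ln r + ln (1 - 2 * r) - ln 2 - ln (x - r) by lra.
by ring.
Qed.

Lemma psi0 : psi (0 : R) = 0.
Proof.
have r0 : rfun (0 : R) = 0.
  rewrite /rfun mulr0 subr0 expr1n mulr1.
  have -> : 1 + 8 = 3 ^+ 2 :> R by ring.
  by rewrite sqrtr_sqr ger0_norm // subrr mul0r.
by rewrite /psi r0 !mulr0 !subr0 mul0r entropy0; ring.
Qed.

(** Adding 2j times the logarithm of the critical equation gives the left side the coefficients of
    the right, so only the arguments of the logarithms differ. The terms in j and n - 2j then cost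
    nothing, and those in k - j and n - k - j cost at most 2 * 4 each, hence 16. *)
Lemma round_exponent_le (n k rho j : R) : 0 <= j -> j <= rho -> rho <= j + 1 ->
  0 < rho -> 3^-1 <= k - rho -> k <= n - k ->
  2 * ((k - rho) * (n - k - rho)) = rho * (n - 2 * rho) ->
  n * ln (n - 2 * rho) - 2 * k * ln (k - rho) - 2 * (n - k) * ln (n - k - rho) <=
  2 * j * ln 2 - 2 * j * ln j + (n - 2 * j) * ln (n - 2 * j)
   - 2 * (k - j) * ln (k - j) - 2 * (n - k - j) * ln (n - k - j) + 16.
Proof.
move=> j0 jr rj r0 kr kn /(congr1 (@ln R)).
rewrite !lnM ?posrE ?mulr_gt0 //; try lra.
move=> /(congr1 (fun t => j * t)) crit.
have h1 : (n - 2 * j) * (ln (n - 2 * rho) - ln (n - 2 * j)) <= 0.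
  by apply: (le_trans (mulr_lnB_le _ _)); lra.
have h2 : j * (ln j - ln rho) <= 0.
  move: j0; rewrite le_eqVlt => /orP[/eqP<-|j0]; first by rewrite mul0r.
  by rewrite pmulr_rle0 // subr_le0 ler_ln.
have h3 : (k - j) * (ln (k - j) - ln (k - rho)) <= 4 by apply: mulr_lnB_le4; lra.
have h4 : (n - k - j) * (ln (n - k - j) - ln (n - k - rho)) <= 4
  by apply: mulr_lnB_le4; lra.
lra.
Qed.

End Exponent.

(** Stirling's bounds are applied to each factorial; the linear terms cancel. Factorials with
    negative sign have total multiplicity 1 + 4 + 2 + 2 = 9 and cost 9; comparing n with n - 2j
    costs at most (ln 2)/2. The half-logarithms of 2j and j leave at worst -(3/2) ln k, the source
    of the power k^(3/2). *)
Lemma ln_fact_ratio_ge (R : realType) (n k j : nat)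
    (h := fun m : nat => m%:R * ln m%:R : R) :
  (0 < k)%N -> (2 * k <= n)%N -> (4 * j <= n)%N -> (j <= k)%N ->
  h (2 * j)%N + h (n - 2 * j)%N + 2 * h k + 2 * h (n - k)%N - h n
    - 4 * h j - 2 * h (k - j)%N - 2 * h (n - k - j)%N - 10 - 3 / 2 * ln k%:R <=
  ln ('C(n, 2 * j)%:R * ('C(2 * j, j)%:R * 'C(n - 2 * j, k - j)%:R) ^+ 2
      / 'C(n, k)%:R ^+ 2).
Proof.
move=> k0 kn jn jk.
have bin0 a b : (b <= a)%N -> 0 < 'C(a, b)%:R :> R by rewrite ltr0n bin_gt0.
have [b1 b2 b3 b4] : [/\ 2 * j <= n, j <= 2 * j, k - j <= n - 2 * j & k <= n]%N by split; lia.
rewrite ln_div ?posrE ?mulr_gt0 ?exprn_gt0 ?mulr_gt0 ?bin0 //.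
rewrite lnM ?posrE ?exprn_gt0 ?mulr_gt0 ?bin0 //.
rewrite !lnXn ?mulr_gt0 ?bin0 // lnM ?posrE ?bin0 // !ln_bin //.
have -> : (2 * j - j = j)%N by lia.
have -> : (n - 2 * j - (k - j) = n - k - j)%N by lia.
pose g m : R := ln (maxn 1 m)%:R.
pose lf m : R := ln m`!%:R.
have B m : h m - m%:R + g m / 2 <= lf m <= h m - m%:R + g m / 2 + 1.
  exact: ln_fact_bounds.
have gk m : (0 < m)%N -> g m = ln m%:R by move=> m0; rewrite /g (maxn_idPr m0).
have gle m m' : (m <= m')%N -> g m <= g m'.
  by move=> mm; rewrite ler_ln ?posrE ?ltr0n ?ler_nat; lia.
(* Since 4j <= n, n is at most 2(n - 2j). *)
have g2 : g n <= ln 2 + g (n - 2 * j)%N.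
  by rewrite -lnM ?posrE ?ltr0n // -?natrM ?ler_ln ?posrE ?ltr0n ?ler_nat; lia.
have l2 : ln 2 <= 1 :> R by have := @ln_le_subr1 R 2; lra.
have [g3 g4 g5 g6] : [/\ g j <= g (2 * j)%N, g (n - k - j)%N <= g (n - k)%N,
  g j <= g k & g (k - j)%N <= g k] by split; apply: gle; lia.
rewrite -!/(lf _) -gk //.
have := B (2 * j)%N; have := B (n - 2 * j)%N; have := B k; have := B (n - k)%N.
have := B n; have := B j; have := B (k - j)%N; have := B (n - k - j)%N.
have e1 : (2 * j)%:R = 2 * j%:R :> R by rewrite natrM.
have e2 : (n - 2 * j)%:R = n%:R - 2 * j%:R :> R by rewrite natrB ?natrM.
have e3 : (n - k)%:R = n%:R - k%:R :> R by rewrite natrB.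
have e4 : (k - j)%:R = k%:R - j%:R :> R by rewrite natrB.
have e5 : (n - k - j)%:R = n%:R - k%:R - j%:R :> R by rewrite -subnDA natrB ?natrD; [ring|lia].
rewrite {}e1 {}e2 {}e3 {}e4 {}e5.
move: h lf g {B gk gle} g2 g3 g4 g5 g6 => h lf g.
move: (h (2 * j)%N) (lf (2 * j)%N) (g (2 * j)%N) => h1 lf1 g1.
move: (h (n - 2 * j)%N) (lf (n - 2 * j)%N) (g (n - 2 * j)%N) => h2 lf2 g2.
move: (h (n - k)%N) (lf (n - k)%N) (g (n - k)%N) => h3 lf3 g3.
move: (h (k - j)%N) (lf (k - j)%N) (g (k - j)%N) => h4 lf4 g4.
move: (h (n - k - j)%N) (lf (n - k - j)%N) (g (n - k - j)%N) => h5 lf5 g5.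
move: (h n) (lf n) (g n) (h k) (lf k) (g k) (h j) (lf j) (g j).
move: n%:R k%:R j%:R (ln 2) l2 => /= *.
repeat match goal with H : is_true (_ && _) |- _ => move/andP: H => [? ?] end.
lra.
Qed.

(** * Assembling the upper and lower bounds *)

Lemma two_powR (R : realType) (y : R) : 2 `^ y = expR (y * ln 2).
Proof. by rewrite /powR pnatr_eq0. Qed.

Lemma ratio_half (R : realType) n k : (0 < k)%N -> (2 * k <= n)%N ->
  0 < (k%:R / n%:R : R) <= 2^-1.
Proof.
move=> k0 kn; have n0 : (0 < n)%N by lia.
rewrite divr_gt0 ?ltr0n //= ler_pdivrMr ?ltr0n //.
by move: kn; rewrite -(ler_nat R) natrM; lra.
Qed.

(* The dual pair (u, v) at which the upper bound (u^(n-k) v^k)^2 is optimal: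
   2 ln u and 2 ln v are the values at 0 and 1 of the tangent to psi ln 2 at x. *)
Lemma psi_tangent (R : realType) (x : R) : 0 < x <= 2^-1 -> exists u v : R,
  [/\ 1 <= u, 1 <= v, u ^+ 2 + v ^+ 2 + 8 = 6 * u * v &
    psi x * ln 2 = 2 * (1 - x) * ln u + 2 * x * ln v].
Proof.
move=> xI; have := rfunP xI; have := psiM_ln2 xI; cbv zeta.
move: (rfun x) => r psiE [crit r0 rx r4]; case/andP: xI => x0 x2.
have [p0 q0 s0] : [/\ 0 < x - r, 0 < 1 - x - r & 0 < 1 - 2 * r] by split; lra.
have w0 : 0 < Num.sqrt (1 - 2 * r) by rewrite sqrtr_gt0.
have w2 := sqr_sqrtr (ltW s0).
set w := Num.sqrt _ in w0 w2.
have lw : ln (1 - 2 * r) = 2 * ln w by rewrite -w2 lnXn // mulr2n; ring.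
(* After clearing denominators, the two inequalities and the curve equation involve [x] only through
   [x * (1 - x)], which the critical equation makes a polynomial in [r]. *)
have yE : x * (1 - x) = (3 * r - 4 * r ^+ 2) / 2 by lra.
have pqE : (x - r) * (1 - x - r) = (r - 2 * r ^+ 2) / 2 by lra.
exists (w * ((1 - x) / (1 - x - r))), (w * (x / (x - r))); split.
- rewrite mulrA ler_pdivlMr // mul1r -(ler_pXn2r (_ : 0 < 2)%N) ?nnegrE ?mulr_ge0 //; try lra.
  rewrite exprMn w2 -subr_ge0.
  have -> : (1 - 2 * r) * (1 - x) ^+ 2 - (1 - x - r) ^+ 2 = 2 * (r * (r * (1 - 2 * r))).
    by have := congr1 (fun t => r * t) yE; lra.
  by rewrite !mulr_ge0 //; lra.
- rewrite mulrA ler_pdivlMr // mul1r -(ler_pXn2r (_ : 0 < 2)%N) ?nnegrE ?mulr_ge0 //; try lra.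
  rewrite exprMn w2 -subr_ge0.
  have -> : (1 - 2 * r) * x ^+ 2 - (x - r) ^+ 2 = 2 * (r * (r * (1 - 2 * r))).
    by have := congr1 (fun t => r * t) yE; lra.
  by rewrite !mulr_ge0 //; lra.
- transitivity ((1 - 2 * r) * ((1 - x) / (1 - x - r)) ^+ 2
     + (1 - 2 * r) * (x / (x - r)) ^+ 2 + 8); first by rewrite -w2; ring.
  transitivity (6 * (1 - 2 * r) * ((1 - x) / (1 - x - r)) * (x / (x - r))); last first.
    by rewrite -w2; ring.
  apply/eqP; rewrite -subr_eq0.
  have -> : (1 - 2 * r) * ((1 - x) / (1 - x - r)) ^+ 2
     + (1 - 2 * r) * (x / (x - r)) ^+ 2 + 8
     - 6 * (1 - 2 * r) * ((1 - x) / (1 - x - r)) * (x / (x - r))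
   = ((1 - 2 * r) * (2 * (x * (1 - x)) ^+ 2 - 2 * r * (x * (1 - x))
        + r ^+ 2 * (1 - 2 * (x * (1 - x)))
        - 6 * (x * (1 - x)) * ((x - r) * (1 - x - r))) + 8 * ((x - r) * (1 - x - r)) ^+ 2)
     / ((x - r) * (1 - x - r)) ^+ 2.
    by field; rewrite !gt_eqF.
  rewrite mulf_eq0; apply/orP; left; apply/eqP.
  by rewrite yE pqE; field.
- have x1 : 0 < 1 - x by lra.
  rewrite psiE lw !lnM ?posrE ?divr_gt0 ?invr_gt0 // !lnV ?posrE //.
  by ring.
Qed.

Lemma mu_slice_le_psi (R : realType) n k : (0 < n)%N -> (2 * k <= n)%N ->
  mu R (slice n k) <= 2 `^ (n%:R * psi (k%:R / n%:R)).
Proof.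
move=> n0 kn; rewrite two_powR; case: (posnP k) => [->|k0].
  (* For [k = 0] the bound is 1, given by the point (1, 3) of the curve. *)
  have -> : expR (n%:R * psi (0%:R / n%:R) * ln 2) = ((1 : R) ^+ (n - 0) * 3 ^+ 0) ^+ 2.
    by rewrite mul0r psi0 mulr0 mul0r expR0 expr0 mulr1 !expr1n.
  by apply: mu_slice_le => //; [lra|ring].
have [u [v [u1 v1 uv psiE]]] := psi_tangent (ratio_half R k0 kn).
have kn' : (k <= n)%N by lia.
apply: (le_trans (mu_slice_le kn' u1 v1 uv)).
have [u0 v0] : 0 < u /\ 0 < v by split; lra.
rewrite -[X in X <= _]lnK ?posrE ?exprn_gt0 ?mulr_gt0 ?exprn_gt0 // ler_expR.
rewrite lnXn ?mulr_gt0 ?exprn_gt0 // lnM ?posrE ?exprn_gt0 // !lnXn // -mulrA psiE.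
rewrite le_eqVlt; apply/orP; left; apply/eqP.
rewrite -(mulr_natr (ln u)) -(mulr_natr (ln v)) mulr2n natrB //; field.
by rewrite pnatr_eq0 -lt0n.
Qed.

(* Only the quadruples (a, b, c, d) for which a + b has weight [2 * j] are
   counted, for the integer j below the critical point [n * rfun (k / n)]. *)
Lemma psi_le_E2 (R : realType) n k : (0 < n)%N -> (2 * k <= n)%N ->
  2 `^ (n%:R * psi (k%:R / n%:R)) <= expR 26 * (maxn 1 k)%:R `^ (3 / 2)
    * ((E2 (slice n k))%:R / #|slice n k|%:R ^+ 2) :> R.
Proof.
move=> n0 kn; rewrite two_powR card_slice; case: (posnP k) => [->|k0].
  rewrite mul0r psi0 mulr0 mul0r expR0 maxn0 powR1 bin0 expr1n divr1 mulr1.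
  have : (1 <= E2 (slice n 0))%N by have := @E2_slice_ge n 0 0 isT; rewrite !bin0.
  rewrite -(ler_nat R) => e1.
  have e2 : 1 <= expR 26 :> R by rewrite -expR0 ler_expR.
  exact: mulr_ege1.
have xI := ratio_half R k0 kn.
have := rfunP xI; have := psiM_ln2 xI; have := rfun_critical xI; cbv zeta.
have n0' : 0 < n%:R :> R by rewrite ltr0n.
have k1 : 1 <= k%:R :> R by rewrite ler1n.
have knR : k%:R <= n%:R - k%:R :> R by move: kn; rewrite -(ler_nat R) natrM; lra.
set r := rfun _ => crit psiE [_ r0 rx r4].
have rho_crit : 2 * ((k%:R - n%:R * r) * (n%:R - k%:R - n%:R * r))
   = n%:R * r * (n%:R - 2 * (n%:R * r)).
  transitivity (n%:R ^+ 2 * (r * (1 - 2 * r))); last by ring.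
  by rewrite -crit; field; rewrite gt_eqF.
have rho0 : 0 < n%:R * r by rewrite mulr_gt0.
have rho4 : n%:R * r <= n%:R / 4 by rewrite ler_pM2l.
have rhok : n%:R * r <= 2 / 3 * k%:R.
  apply: le_trans (ler_wpM2l (ltW n0') rx) _; rewrite le_eqVlt.
  by apply/orP; left; apply/eqP; field; rewrite gt_eqF.
have nE : n%:R * psi (k%:R / n%:R) * ln 2 =
   n%:R * ln (n%:R - 2 * (n%:R * r)) - n%:R * ln n%:R
   + 2 * k%:R * (ln k%:R - ln (k%:R - n%:R * r))
   + 2 * (n%:R - k%:R) * (ln (n%:R - k%:R) - ln (n%:R - k%:R - n%:R * r)).
  rewrite -mulrA psiE.
  have -> : 1 - 2 * r = (n%:R - 2 * (n%:R * r)) / n%:R by field; rewrite gt_eqF.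
  have -> : k%:R / n%:R - r = (k%:R - n%:R * r) / n%:R by field; rewrite gt_eqF.
  have -> : 1 - k%:R / n%:R - r = (n%:R - k%:R - n%:R * r) / n%:R by field; rewrite gt_eqF.
  have -> : 1 - k%:R / n%:R = (n%:R - k%:R) / n%:R :> R by field; rewrite gt_eqF.
  rewrite !ln_div ?posrE //; try lra.
  by field; rewrite gt_eqF.
rewrite nE; move: rho_crit rho0 rho4 rhok; move: (n%:R * r) => rho {nE psiE crit r0 rx r4 r}.
move=> crit rho0 rho4 rhok.
(* From here j is the integer part of rho = nr. *)
have /andP[] := truncn_itv (ltW rho0); move: (Num.truncn rho) => j jr rj.
rewrite -natr1 in rj.
have jk : (j <= k)%N by rewrite -(ler_nat R); lra.
have j4 : (4 * j <= n)%N by rewrite -(ler_nat R) natrM; lra.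
have round := @round_exponent_le R n%:R k%:R rho j%:R.
have {}round := round (ler0n _ _) jr (ltW rj) rho0.
have {}round := round ltac:(lra) knR crit.
have low := ln_fact_ratio_ge R k0 kn j4 jk; cbv zeta in low.
have bin_pos a b : (b <= a)%N -> 0 < 'C(a, b)%:R :> R by rewrite ltr0n bin_gt0.
have [b1 b2 b3 b4] : [/\ 2 * j <= n, j <= 2 * j, k - j <= n - 2 * j & k <= n]%N
  by clear -kn j4 jk; split; lia.
have b5 : (j <= n - k)%N by clear -kn j4 jk; lia.
set T := _ / _ ^+ 2 in low.
have T0 : 0 < T.
  by rewrite divr_gt0 ?mulr_gt0 ?exprn_gt0 ?mulr_gt0 ?bin_pos.
have TE : T <= (E2 (slice n k))%:R / 'C(n, k)%:R ^+ 2.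
  rewrite ler_pM2r ?invr_gt0 ?exprn_gt0 ?bin_pos //.
  by rewrite -natrM -natrX -natrM ler_nat E2_slice_ge.
rewrite (maxn_idPr _) //.
apply: (@le_trans _ _ (expR 26 * k%:R `^ (3 / 2) * T)); last first.
  by rewrite ler_wpM2l // mulr_ge0 ?expR_ge0 ?powR_ge0.
rewrite /powR gt_eqF ?ltr0n // -{1}(lnK (_ : T \is Num.pos)) ?posrE //.
(* The constant 26 is 16 from rounding plus 10 from Stirling. *)
rewrite -!expRD ler_expR.
have h2j : (2 * j)%:R * ln (2 * j)%:R - 4 * (j%:R * ln j%:R)
    = 2 * j%:R * ln 2 - 2 * j%:R * ln j%:R :> R.
  (* The logarithm of 2j splits only for j > 0; at j = 0 every term has a factor 0. *)
  case: (posnP j) => [->|j0]; first by rewrite !mul0r !mulr0 !mul0r subrr.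
  by rewrite natrM lnM ?posrE ?ltr0n //; ring.
rewrite !natrB // (natrM R 2 j) in low; rewrite (natrM R 2 j) in h2j.
lra.
Qed.

Theorem theorem1p8 (R : realType) :
  exists C : R, 0 < C /\
    forall n k : nat, (0 < n)%N -> (2 * k <= n)%N ->
      mu R (slice n k) <= 2 `^ (n%:R * psi (k%:R / n%:R))
      /\ 2 `^ (n%:R * psi (k%:R / n%:R)) <=
         C * (maxn 1 k)%:R `^ (3 / 2)
           * ((E2 (slice n k))%:R / #|slice n k|%:R ^+ 2).
Proof.
exists (expR 26); split=> [|n k n0 kn]; first exact: expR_gt0.
by split; [exact: mu_slice_le_psi | exact: psi_le_E2].
Qed.
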